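(* Let $n\ge2$ be finite. If $d$ is a cocycle on $G_n$, define a continuous real valued function $f_d$ on $X$ by $f_d(x)=d(x,1,Sx)$ for all $x\in X$. If $f:X\to\mathbb{R}$ is continuous, define a cocycle $d_f$ on $G_n$ by $$d_f(x,k,S^ky)=\sum_{j=0}^{k-1}f(S^jx)+\sum_{j=k}^{\infty}[f(S^jx)-f(S^jy)],$$ $$d_f(S^kx,-k,y)=-\sum_{j=0}^{k-1}f(S^jy)+\sum_{j=k}^{\infty}[f(S^jx)-f(S^jy)],$$ where $k\ge0$ and $(x,0,y)\in P_{UHF}$. (That is, $f_d$ is continuous, and $d_f$ is a well-defined cocycle on all of $G_n$.) These two correspondences $d\mapsto f_d$ and $f\mapsto d_f$ are inverse to one another. Thus there is a one-to-one correspondence between continuous cocycles on $G_n$ and continuous real valued functions on $X$.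
   Context: Fix a finite $n\ge 2$. $X=\prod_{1}^{\infty}\{1,\dots,n\}$ with the product topology. For a (possibly empty) finite string $\alpha$ in $\{1,\dots,n\}$, $\ell(\alpha)$ is its length, and $\alpha\gamma$ ($\gamma\in X$) is the concatenation. The Cuntz groupoid is $G_n=\{(\alpha\gamma,\ell(\alpha)-\ell(\beta),\beta\gamma)\mid \alpha,\beta \text{ finite strings},\ \gamma\in X\}$ with $(x,k,y)(y,j,z)=(x,k+j,z)$, $(x,k,y)^{-1}=(y,-k,x)$, and topology with basis the sets $U_{\alpha,\beta}=\{(\alpha\gamma,\ell(\alpha)-\ell(\beta),\beta\gamma)\mid\gamma\in X\}$. $P_{UHF}=\{(x,k,y)\in G_n\mid k=0\}$. A cocycle is a continuous function $d:G_n\to\mathbb{R}$ with $d(x,k,y)+d(y,l,z)=d(x,k+l,z)$ for all $(x,k,y),(y,l,z)\in G_n$. $S:X\to X$ is the backward shift $S(x_1,x_2,x_3,\dots)=(x_2,x_3,\dots)$. Every element of $G_n$ has the form $(x,k,S^ky)$ or $(S^kx,-k,y)$ with $k\ge0$ and $(x,0,y)\in P_{UHF}$; for such $x,y$ one has $S^jx=S^jy$ for all large $j$, so the infinite sums are finite. *)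

(* Defs.v *)
From HB Require Import structures.
From mathcomp Require Import all_boot all_order all_algebra.
From mathcomp Require Import zify.
From mathcomp Require Import all_classical all_reals all_analysis.
Set Implicit Arguments.
Unset Strict Implicit.
Unset Printing Implicit Defensive.
Import Order.TTheory GRing.Theory Num.Theory.
Import numFieldNormedType.Exports.
Local Open Scope classical_set_scope.
Local Open Scope ring_scope.

(* The alphabet {1, ..., n} is represented by 'I_n = {0, ..., n - 1}, and the
   coordinates of a point of the path space are indexed from 0. *)
Definition path_space (n : nat) : Type :=
  prod_topology (fun _ : nat => discrete_topology 'I_n).
HB.instance Definition _ (n : nat) := Topological.on (path_space n).

Definition word (n : nat) : Type := seq 'I_n.
HB.instance Definition _ (n : nat) := Choice.on (word n).
HB.instance Definition _ (n : nat) := isPointed.Build (word n) [::].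

(* For i < size a this is the i-th letter of a; beyond the end of a, nth returns
   its default value, the letter of c at position i - size a. *)
Definition concat (n : nat) (a : word n) (c : path_space n) : path_space n :=
  fun i => nth (c (i - size a)%N) a i.

Definition backshift (n : nat) (x : path_space n) : path_space n := fun i => x i.+1.

Definition cuntz_set (n : nat) : set (path_space n * int * path_space n) :=
  [set t | exists (a b : word n) (c : path_space n),
     t = (concat a c, (size a)%:Z - (size b)%:Z, concat b c)].

Definition puhf (n : nat) : set (path_space n * int * path_space n) :=
  [set t | cuntz_set t /\ t.1.2 = 0].

(* G_n is a type of its own, since its topology is not the one induced by the
   product X * Z * X. *)
Record cuntz (n : nat) := Cuntz {
  arrow :> path_space n * int * path_space n;
  arrowP : arrow \in @cuntz_set n }.
Arguments Cuntz {n} arrow arrowP.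

HB.instance Definition _ (n : nat) := [isSub of cuntz n for @arrow n].
HB.instance Definition _ (n : nat) := [Choice of cuntz n by <:].

Definition cuntz_basic (n : nat) (ab : word n * word n) : set (cuntz n) :=
  [set g | exists c : path_space n,
     arrow g = (concat ab.1 c, (size ab.1)%:Z - (size ab.2)%:Z, concat ab.2 c)].

Lemma concat_lt (n : nat) (a : word n) (c c' : path_space n) (i : nat) :
  (i < size a)%N -> concat a c i = concat a c' i.
Proof. by move=> ia; rewrite /concat; apply: set_nth_default. Qed.

Lemma concat_ge (n : nat) (a : word n) (c : path_space n) (i : nat) :
  (size a <= i)%N -> concat a c i = c (i - size a)%N.
Proof. by move=> ia; rewrite /concat nth_default. Qed.

Lemma concat_mkseq (n : nat) (x : path_space n) (p : nat) :
  concat (mkseq x p) (fun i => x (p + i)%N) = x.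
Proof.
apply/funext => i; have [ip|pi] := ltnP i p.
  by rewrite /concat nth_mkseq.
by rewrite concat_ge size_mkseq // subnKC.
Qed.

Lemma cuntz_setP (n : nat) (x : path_space n) (k : int) (y : path_space n) :
  cuntz_set (x, k, y) <->
  exists p q : nat, k = p%:Z - q%:Z /\ forall i, x (p + i)%N = y (q + i)%N.
Proof.
split=> [[a [b [c [-> -> ->]]]]|[p [q [-> xy]]]].
  exists (size a), (size b); split=> // i.
  by rewrite !concat_ge ?leq_addr// !addKn.
exists (mkseq x p), (mkseq y q), (fun i => x (p + i)%N).
rewrite !size_mkseq concat_mkseq; congr (_, _, _).
by rewrite (funext xy) concat_mkseq.
Qed.

Lemma cuntz_set_mul (n : nat) (x y z : path_space n) (k l : int) :
  (x, k, y) \in @cuntz_set n -> (y, l, z) \in @cuntz_set n ->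
  (x, k + l, z) \in @cuntz_set n.
Proof.
rewrite !inE => /cuntz_setP[p [q [-> xy]]] /cuntz_setP[p' [q' [-> yz]]].
apply/cuntz_setP; exists (p + p')%N, (q' + q)%N; split; first by lia.
by move=> i; rewrite -addnA xy addnCA yz addnA.
Qed.

Lemma cuntz_set_shift (n : nat) (x : path_space n) :
  (x, 1, backshift x) \in @cuntz_set n.
Proof. by rewrite inE; apply/cuntz_setP; exists 1%N, 0%N. Qed.

Lemma cuntz_basic_cover (n : nat) :
  \bigcup_(ab in [set: word n * word n]) cuntz_basic ab = setT.
Proof.
apply/seteqP; split=> // g _; have := arrowP g.
by rewrite inE => -[a [b [c gE]]]; exists (a, b) => //; exists c.
Qed.

Lemma cuntz_basic_sub (n : nat) (a b a' b' : word n) (g : cuntz n) :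
  cuntz_basic (a, b) g -> cuntz_basic (a', b') g -> (size a <= size a')%N ->
  cuntz_basic (a', b') `<=` cuntz_basic (a, b).
Proof.
move=> [c /= gE] [c' /=]; rewrite gE => -[ac kE bc] aa' h [e /= hE].
have bb' : (size b <= size b')%N by lia.
exists (fun i => concat a' e (size a + i)%N); rewrite /= hE; congr (_, _, _) => //.
  apply/funext => i; have [ia|ai] := ltnP i (size a); last first.
    by rewrite [RHS]concat_ge// subnKC.
  by rewrite (concat_lt e c') ?(leq_trans ia)// -ac; apply: concat_lt.
apply/funext => i; have [ib|bi] := ltnP i (size b).
  by rewrite (concat_lt e c') ?(leq_trans ib)// -bc; apply: concat_lt.
rewrite [RHS]concat_ge//; have [ib'|bi'] := ltnP i (size b').
  rewrite (concat_lt e c')// -bc concat_ge// (@concat_lt _ a' e c'); last by lia.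
  by rewrite -ac concat_ge ?leq_addr// addKn.
by rewrite !concat_ge//; first congr (e _); lia.
Qed.

Lemma cuntz_basic_join (n : nat) (i j : word n * word n) (g : cuntz n) :
  [set: word n * word n] i -> [set: word n * word n] j ->
  cuntz_basic i g -> cuntz_basic j g ->
  exists k, [/\ [set: word n * word n] k, cuntz_basic k g &
                cuntz_basic k `<=` cuntz_basic i `&` cuntz_basic j].
Proof.
case: i j => [a b] [a' b'] _ _ gi gj.
have [aa'|a'a] := leqP (size a) (size a').
  exists (a', b'); split=> // h hj; split=> //.
  exact: cuntz_basic_sub gi gj aa' _ hj.
exists (a, b); split=> // h hi; split=> //.
exact: cuntz_basic_sub gj gi (ltnW a'a) _ hi.
Qed.

HB.instance Definition _ (n : nat) := isBaseTopological.Build (cuntz n)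
  (@cuntz_basic_cover n) (@cuntz_basic_join n).

Definition cocycle (R : realType) (n : nat) (d : cuntz n -> R) : Prop :=
  continuous d /\
  forall (x y z : path_space n) (k l : int)
    (g : (x, k, y) \in @cuntz_set n) (h : (y, l, z) \in @cuntz_set n),
    d (Cuntz (x, k, y) g) + d (Cuntz (y, l, z) h) =
    d (Cuntz (x, k + l, z) (cuntz_set_mul g h)).

Definition fun_of_cocycle (R : realType) (n : nat) (d : cuntz n -> R)
    (x : path_space n) : R :=
  d (Cuntz (x, 1, backshift x) (cuntz_set_shift x)).

(* v is a value prescribed for d_f at g by one of the two defining formulas, for
   some way of writing g as (x, k, S^k y) or as (S^k x, -k, y). *)
Definition cocycle_value (R : realType) (n : nat) (f : path_space n -> R)
    (g : cuntz n) (v : R) : Prop :=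
  (exists (k : nat) (x y : path_space n),
    [/\ puhf (x, 0, y), arrow g = (x, k%:Z, iter k (@backshift n) y) &
        v = \sum_(0 <= j < k) f (iter j (@backshift n) x) +
            \big[+%R/0]_(k <= j <oo)
              (f (iter j (@backshift n) x) - f (iter j (@backshift n) y))]) \/
  (exists (k : nat) (x y : path_space n),
    [/\ puhf (x, 0, y), arrow g = (iter k (@backshift n) x, - k%:Z, y) &
        v = - (\sum_(0 <= j < k) f (iter j (@backshift n) y)) +
            \big[+%R/0]_(k <= j <oo)
              (f (iter j (@backshift n) x) - f (iter j (@backshift n) y))]).

(* Meaningful when the prescribed value exists and is unique. *)
Definition cocycle_of_fun (R : realType) (n : nat) (f : path_space n -> R)
    (g : cuntz n) : R :=
  get [set v | cocycle_value f g v].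

(* Main.v *)
Require Import Defs.
From HB Require Import structures.
From mathcomp Require Import all_boot all_order all_algebra.
From mathcomp Require Import zify ring.
From mathcomp Require Import all_classical all_reals all_analysis.
Import Order.TTheory GRing.Theory Num.Theory.
Import numFieldNormedType.Exports.
Local Open Scope classical_set_scope.
Local Open Scope ring_scope.
Set Implicit Arguments.
Unset Strict Implicit.
Unset Printing Implicit Defensive.

(** The key is a formula for d_f without infinite sums. An arrow (x, k, y) of
    G_n comes with p, q such that k = p - q and S^p x = S^q y; writing
    B_p f x = f x + f (S x) + ... + f (S^(p-1) x) for the Birkhoff sum, both
    defining formulas of d_f say that
      d_f (x, k, y) = B_p f x - B_q f y,
    because their series vanish beyond the rank where the two paths have merged,
    and then telescope against the finite sums ([cocycle_valueP]).

    The right-hand side does not depend on (p, q): raising both by m adds the same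
    sum B_m f (S^p x) = B_m f (S^q y) to the two terms ([orbit_sum_unique]). This
    gives well-definedness. The cocycle identity follows in the same way from
    B_(p+m) f x = B_p f x + B_m f (S^p x). Continuity holds because on the basic
    open set U_(a,b) the fixed pair (length of a, length of b) may be used, and there
    d_f is a finite combination of f composed with continuous maps.

    In the other direction, x |-> (x, 1, S x) is continuous into G_n, so f_d is
    continuous. The arrow (x, k, y) factors through z = S^p x = S^q y as p shift
    arrows followed by the inverses of q shift arrows, so additivity forces
    d (x, k, y) = B_p f_d x - B_q f_d y, that is d = d_(f_d)
    ([cocycle_birkhoff]). Taking (p, q) = (1, 0) gives f_(d_f) = f. *)

Notation shift k := (iter k (@backshift _)).

(** * Birkhoff sums along the shift *)

Definition birkhoff (R : realType) (n : nat) (f : path_space n -> R) (p : nat)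
    (x : path_space n) : R :=
  \sum_(0 <= j < p) f (shift j x).

Lemma shiftE (n : nat) (p : nat) (x : path_space n) (i : nat) :
  shift p x i = x (p + i)%N.
Proof. by elim: p i => // p IH i; rewrite iterS /backshift IH addSnnS. Qed.

Lemma shiftD (n : nat) (p q : nat) (x : path_space n) :
  shift (p + q) x = shift q (shift p x).
Proof. by rewrite addnC iterD. Qed.

Lemma shift_concat (n : nat) (a : word n) (c : path_space n) :
  shift (size a) (concat a c) = c.
Proof. by apply/funext => i; rewrite shiftE concat_ge ?leq_addr// addKn. Qed.

Lemma birkhoffD (R : realType) (n : nat) (f : path_space n -> R) (p q : nat)
    (x : path_space n) :
  birkhoff f (p + q) x = birkhoff f p x + birkhoff f q (shift p x).
Proof.
rewrite /birkhoff (@big_cat_nat _ _ _ p) ?leq_addr//=; congr (_ + _).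
rewrite -{1}[p]add0n big_addn addKn; apply: eq_bigr => i _.
by rewrite addnC shiftD.
Qed.

Lemma birkhoff_range (R : realType) (n : nat) (f : path_space n -> R) (k N : nat)
    (x : path_space n) : (k <= N)%N ->
  \sum_(k <= j < N) f (shift j x) = birkhoff f N x - birkhoff f k x.
Proof.
by move=> kN; rewrite /birkhoff (@big_cat_nat _ _ _ k 0 N)//= addrAC subrr add0r.
Qed.

(** * The finite formula for the cocycle of a function *)

(** A relation on values rather than a function of the arrow, because an arrow
    (x, k, y) does not determine p and q but only their difference. *)
Definition orbit_sum (R : realType) (n : nat) (f : path_space n -> R)
    (x : path_space n) (k : int) (y : path_space n) (v : R) : Prop :=
  exists p q : nat, [/\ k = p%:Z - q%:Z, shift p x = shift q y &
                        v = birkhoff f p x - birkhoff f q y].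

Lemma cuntz_set_orbit (n : nat) (x : path_space n) (k : int) (y : path_space n) :
  cuntz_set (x, k, y) <->
  exists p q : nat, k = p%:Z - q%:Z /\ shift p x = shift q y.
Proof.
rewrite cuntz_setP; split=> -[p [q [kE xy]]]; exists p, q; split=> //.
  by apply/funext => i; rewrite !shiftE.
by move=> i; rewrite -!shiftE xy.
Qed.

(** Two pairs (p, q) with the same difference differ by a common summand m, which
    contributes the same Birkhoff sum at the common point S^p x = S^q y. *)
Lemma orbit_sum_unique (R : realType) (n : nat) (f : path_space n -> R)
    (x : path_space n) (k : int) (y : path_space n) (v w : R) :
  orbit_sum f x k y v -> orbit_sum f x k y w -> v = w.
Proof.
suff extend p q m : shift p x = shift q y ->
    birkhoff f (p + m) x - birkhoff f (q + m) y = birkhoff f p x - birkhoff f q y.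
  move=> [p [q [-> xy ->]]] [p' [q' [kE xy' ->]]].
  have [pp'|/ltnW p'p] := leqP p p'.
    have -> : p' = (p + (p' - p))%N by lia.
    have -> : q' = (q + (p' - p))%N by lia.
    by rewrite extend.
  have -> : p = (p' + (p - p'))%N by lia.
  have -> : q = (q' + (p - p'))%N by lia.
  by rewrite extend.
by move=> xy; rewrite !birkhoffD xy; ring.
Qed.

Lemma orbit_sumD (R : realType) (n : nat) (f : path_space n -> R)
    (x y z : path_space n) (k l : int) (v w : R) :
  orbit_sum f x k y v -> orbit_sum f y l z w -> orbit_sum f x (k + l) z (v + w).
Proof.
move=> [p [q [-> xy ->]]] [p' [q' [-> yz ->]]].
exists (p + p')%N, (q' + q)%N; split; first by lia.
  by rewrite !shiftD xy -yz -!shiftD addnC.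
(* B_(q + p') f y, expanded in both orders. *)
have : birkhoff f q y + birkhoff f p' (shift q y) =
       birkhoff f p' y + birkhoff f q (shift p' y).
  by rewrite -!birkhoffD addnC.
rewrite !birkhoffD xy -yz => yE.
have -> : birkhoff f p' (shift q y) =
  birkhoff f p' y + birkhoff f q (shift p' y) - birkhoff f q y by rewrite -yE; ring.
ring.
Qed.

(** Past the rank p where the two paths have merged all terms vanish, so that the
    series is one of its partial sums. *)
Lemma tail_series (R : realType) (n : nat) (f : path_space n -> R)
    (x y : path_space n) (k p : nat) : shift p x = shift p y ->
  \big[+%R/0]_(k <= j <oo) (f (shift j x) - f (shift j y)) =
  (birkhoff f (k + p) x - birkhoff f k x) -
  (birkhoff f (k + p) y - birkhoff f k y).
Proof.
move=> xy; apply: lim_near_cst => //; exists (k + p)%N => // N /= kpN.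
have kp : (k <= k + p)%N by exact: leq_addr.
rewrite (@big_cat_nat _ _ _ (k + p))//= [X in _ + X]big_nat_cond [X in _ + X]big1.
  by rewrite addr0 sumrB !birkhoff_range.
move=> j /andP[/andP[kpj _] _].
have -> : j = (p + (j - p))%N by lia.
by rewrite !shiftD xy subrr.
Qed.

Lemma puhf_orbit (n : nat) (x y : path_space n) :
  puhf (x, 0, y) <-> exists p, shift p x = shift p y.
Proof.
split=> [[/cuntz_set_orbit[p [q [pq xy]]] _]|[p xy]].
  by exists p; rewrite xy; congr (shift _ y); lia.
by split=> //; apply/cuntz_set_orbit; exists p, p; split=> //; rewrite subrr.
Qed.

(** If S^p x = S^p y, then S^(k+p) x = S^p (S^k y), and by [tail_series] the formula
    attached to the arrow (x, k, S^k y) is the orbit sum for the pair (k + p, p); the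
    formula for (S^k x, -k, y) is the one for (p, k + p). *)
Lemma cocycle_value_orbit_sum (R : realType) (n : nat) (f : path_space n -> R)
    (g : cuntz n) (v : R) :
  cocycle_value f g v -> orbit_sum f (arrow g).1.1 (arrow g).1.2 (arrow g).2 v.
Proof.
move=> [[k [x [y [/puhf_orbit[p xy] -> ->]]]]|[k [x [y [/puhf_orbit[p xy] -> ->]]]]].
- exists (k + p)%N, p => /=; split; first by lia.
    by rewrite -shiftD addnC !shiftD xy.
  rewrite (tail_series f k xy) (birkhoffD f k p y) -/(birkhoff f k x).
  by ring.
- exists p, (k + p)%N => /=; split; first by lia.
    by rewrite -shiftD addnC !shiftD xy.
  rewrite (tail_series f k xy) (birkhoffD f k p x) -/(birkhoff f k y).
  by ring.
Qed.

(** An arrow (x, k, y) with k >= 0 is of the form (x, k, S^k y') where y' is y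
    preceded by the first k letters of x (any k letters would do, since only the
    far tails have to agree). The case k <= 0 is symmetric. *)
Lemma cocycle_value_exists (R : realType) (n : nat) (f : path_space n -> R)
    (g : cuntz n) : exists v, cocycle_value f g v.
Proof.
case: g => -[[x k] y] gP.
have := set_mem gP => /cuntz_set_orbit[p [q [kE xy]]].
have [qp|/ltnW pq] := leqP q p.
  set a : word n := mkseq x (p - q).
  have ap : size a = (p - q)%N by rewrite size_mkseq.
  have ay : shift (p - q) (concat a y) = y by rewrite -ap shift_concat.
  eexists; left; exists (p - q)%N, x, (concat a y); split; last reflexivity.
    apply/puhf_orbit; exists p.
    by rewrite xy -[in RHS](subnK qp) shiftD ay.
  by rewrite /= ay; congr (_, _, _); lia.
set a : word n := mkseq y (q - p).
have aq : size a = (q - p)%N by rewrite size_mkseq.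
have ax : shift (q - p) (concat a x) = x by rewrite -aq shift_concat.
eexists; right; exists (q - p)%N, (concat a x), y; split; last reflexivity.
  apply/puhf_orbit; exists q.
  by rewrite -xy -[in LHS](subnK pq) shiftD ax.
by rewrite /= ax; congr (_, _, _); lia.
Qed.

Lemma cocycle_valueP (R : realType) (n : nat) (f : path_space n -> R)
    (g : cuntz n) (v : R) :
  cocycle_value f g v <-> orbit_sum f (arrow g).1.1 (arrow g).1.2 (arrow g).2 v.
Proof.
split=> [|vg]; first exact: cocycle_value_orbit_sum.
have [w wg] := cocycle_value_exists f g.
by rewrite (orbit_sum_unique vg (cocycle_value_orbit_sum wg)).
Qed.

Lemma cocycle_of_funP (R : realType) (n : nat) (f : path_space n -> R)
    (g : cuntz n) :
  orbit_sum f (arrow g).1.1 (arrow g).1.2 (arrow g).2 (cocycle_of_fun f g).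
Proof.
apply/cocycle_valueP; rewrite /cocycle_of_fun.
exact: (@getPex _ [set v | cocycle_value f g v] (cocycle_value_exists f g)).
Qed.

Lemma cocycle_of_funE (R : realType) (n : nat) (f : path_space n -> R)
    (g : cuntz n) (v : R) :
  orbit_sum f (arrow g).1.1 (arrow g).1.2 (arrow g).2 v -> cocycle_of_fun f g = v.
Proof. exact/orbit_sum_unique/cocycle_of_funP. Qed.

(** * Topology of the path space and of the groupoid *)

Lemma near_coord (n : nat) (x : path_space n) (i : nat) :
  \forall y \near x, y i = x i.
Proof.
exact: (@proj_continuous nat (fun=> discrete_topology 'I_n) i x _
          (discrete_set1 (x i : discrete_topology 'I_n))).
Qed.

(** The factors are discrete, so a map into the product is continuous at t as soon as
    each of its coordinates is constant near t. *)
Lemma path_continuous (T : topologicalType) (n : nat) (h : T -> path_space n)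
    (t : T) :
  (forall i, \forall u \near t, h u i = h t i) -> h @ t --> h t.
Proof.
move=> ht; apply/cvg_sup => i U [V] [[W] oW <-] Wx WU.
apply: (@filterS _ (nbhs t) _ _ _ _ (ht i)) => u hu; apply: WU.
by rewrite /preimage/= hu.
Qed.

Lemma near_prefix (n : nat) (x : path_space n) (p : nat) :
  \forall y \near x, forall i, (i < p)%N -> y i = x i.
Proof.
elim: p => [|p IH]; last first.
  apply: filterS2 IH (near_coord x p) => y yx ypx i.
  by rewrite ltnS leq_eqVlt => /predU1P[->|/yx].
by apply: (@filterS _ (nbhs x) _ setT) => [y _ i|]; [rewrite ltn0|exact: filterT].
Qed.

Lemma shift_continuous (n : nat) (p : nat) :
  continuous (iter p (@backshift n)).
Proof.
move=> x; apply: path_continuous => i.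
apply: (@filterS _ (nbhs x) _ _ _ _ (near_coord x (p + i))) => y.
by rewrite !shiftE.
Qed.

Lemma birkhoff_continuous (R : realType) (n : nat) (f : path_space n -> R) (p : nat) :
  continuous f -> continuous (birkhoff f p).
Proof.
move=> fc; apply: (@continuous_big R nat _ _ _ _ (path_space n) (index_iota 0 p)
  (fun j x => f (shift j x))) => [|j _ x]; first exact: add_continuous.
by apply: (@continuous_comp _ _ _ (iter j (@backshift n)) f);
  [exact: shift_continuous|exact: fc].
Qed.

Lemma cuntz_nbhsP (n : nat) (g : cuntz n) (A : set (cuntz n)) :
  nbhs g A <-> exists ab, cuntz_basic ab g /\ cuntz_basic ab `<=` A.
Proof.
rewrite nbhsE; split=> [[B [[D _ <-] [ab Dab gab]] BA]|[ab [gab abA]]].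
  by exists ab; split=> // h hab; apply: BA; exists ab.
exists (cuntz_basic ab) => //; split=> //.
by exists [set ab] => //; rewrite bigcup_set1.
Qed.

(** Lengthening both words a and b by the first i + 1 letters of their common tail
    yields a smaller basic open set, on which the coordinates of index at most i of
    the range and of the source are constant. *)
Lemma near_endpoints (n : nat) (g : cuntz n) (i : nat) :
  \forall h \near g, (arrow h).1.1 i = (arrow g).1.1 i /\
                     (arrow h).2 i = (arrow g).2 i.
Proof.
apply/cuntz_nbhsP; have := arrowP g; rewrite inE => -[a [b [c gE]]].
pose a' : word n := a ++ mkseq c i.+1; pose b' : word n := b ++ mkseq c i.+1.
have catE (w : word n) : concat w c = concat (w ++ mkseq c i.+1) (shift i.+1 c).
  apply/funext => j; rewrite /concat nth_cat size_cat size_mkseq.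
  case: ltnP => [jw|wj]; first exact: set_nth_default.
  rewrite nth_default//; have [ji|ij] := ltnP (j - size w) i.+1.
    by rewrite nth_mkseq.
  by rewrite nth_default ?size_mkseq// shiftE; congr (c _); lia.
have agree (w : word n) (e : path_space n) :
    concat (w ++ mkseq c i.+1) e i = concat w c i.
  by rewrite catE; apply: concat_lt; rewrite size_cat size_mkseq; lia.
exists (a', b'); split.
  exists (shift i.+1 c); rewrite gE /= -!catE !size_cat.
  by congr (_, _, _); lia.
by move=> h [e ->]; rewrite gE /= !agree.
Qed.

Lemma range_continuous (n : nat) : continuous (fun g : cuntz n => (arrow g).1.1).
Proof.
by move=> g; apply: path_continuous => i; apply: filterS (near_endpoints g i) => h [].
Qed.

Lemma source_continuous (n : nat) : continuous (fun g : cuntz n => (arrow g).2).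
Proof.
by move=> g; apply: path_continuous => i; apply: filterS (near_endpoints g i) => h [].
Qed.

Definition shift_arrow (n : nat) (x : path_space n) : cuntz n :=
  Cuntz (x, 1, backshift x) (cuntz_set_shift x).

(** If (x, 1, S x) lies in U_(a,b), then a is one letter longer than b and b is a
    without its first letter; so every path beginning with a is sent into U_(a,b) as
    well. *)
Lemma shift_arrow_continuous (n : nat) : continuous (@shift_arrow n).
Proof.
move=> x A /cuntz_nbhsP[[a b] [[c /= [xE abE sxE]] abA]].
rewrite nbhs_simpl /=; apply: filterS (near_prefix x (size a)) => y yx.
apply: abA; exists (shift (size a) y) => /=.
have ab : size a = (size b).+1 by lia.
congr (_, _, _) => //; apply/funext => i.
  have [ia|ai] := ltnP i (size a); last first.
    by rewrite concat_ge// shiftE subnKC.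
  by rewrite yx// xE; exact: concat_lt.
have [ib|bi] := ltnP i (size b); last first.
  by rewrite concat_ge// shiftE ab addSn subnKC.
by rewrite /backshift yx ?ab// -/(backshift x i) sxE; exact: concat_lt.
Qed.

(** * From functions to cocycles and back *)

Lemma cocycle_of_fun_continuous (R : realType) (n : nat) (f : path_space n -> R) :
  continuous f -> continuous (cocycle_of_fun f).
Proof.
move=> fc g; have := arrowP g; rewrite inE => -[a [b [c gE]]].
pose F (h : cuntz n) :=
  birkhoff f (size a) (arrow h).1.1 - birkhoff f (size b) (arrow h).2.
have FE h : cuntz_basic (a, b) h -> cocycle_of_fun f h = F h.
  move=> [e hE]; apply: cocycle_of_funE; exists (size a), (size b).
  by rewrite /F hE /= !shift_concat.
have gab : cuntz_basic (a, b) g by exists c.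
have Fc : {for g, continuous F}.
  have cc := @continuous_comp (cuntz n) (path_space n) R.
  apply: (@cvgB _ _ _ (nbhs g)).
    apply: (cc _ (birkhoff f (size a))); first exact: range_continuous.
    exact: birkhoff_continuous.
  apply: (cc _ (birkhoff f (size b))); first exact: source_continuous.
  exact: birkhoff_continuous.
rewrite /continuous_at (FE g gab); apply: cvg_trans Fc; apply: (@near_eq_cvg _ _ (nbhs g)).
by apply/cuntz_nbhsP; exists (a, b); split=> // h /FE.
Qed.

Lemma cocycle_of_fun_cocycle (R : realType) (n : nat) (f : path_space n -> R) :
  continuous f -> cocycle (cocycle_of_fun f).
Proof.
move=> fc; split=> [|x y z k l g h]; first exact: cocycle_of_fun_continuous.
apply/esym/cocycle_of_funE => /=.
exact: orbit_sumD (cocycle_of_funP f (Cuntz _ g)) (cocycle_of_funP f (Cuntz _ h)).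
Qed.

Lemma cocycle_of_funK (R : realType) (n : nat) (f : path_space n -> R) :
  fun_of_cocycle (cocycle_of_fun f) = f.
Proof.
apply/funext => x; apply: cocycle_of_funE; exists 1%N, 0%N; split=> //.
by rewrite /birkhoff big_nat1 big_geq// subr0.
Qed.

Lemma fun_of_cocycle_continuous (R : realType) (n : nat) (d : cuntz n -> R) :
  cocycle d -> continuous (fun_of_cocycle d).
Proof.
move=> [dc _] x; apply: (@continuous_comp _ _ _ (@shift_arrow n) d).
  exact: shift_arrow_continuous.
exact: dc.
Qed.

Lemma cocycleD (R : realType) (n : nat) (d : cuntz n -> R) (g h gh : cuntz n)
    (x y z : path_space n) (k l m : int) : cocycle d ->
  arrow g = (x, k, y) -> arrow h = (y, l, z) -> arrow gh = (x, m, z) ->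
  m = k + l -> d gh = d g + d h.
Proof.
case: g h gh => [g gP] [h hP] [gh ghP] [_ dD] /= gE hE ghE mE; subst.
by rewrite dD; congr (d _); apply: val_inj.
Qed.

(** The arrow (x, p, S^p x) is a product of p shift arrows. For p = 0, additivity on
    (x, 0, x)(x, 0, x) = (x, 0, x) makes d vanish on units. *)
Lemma cocycle_forward (R : realType) (n : nat) (d : cuntz n -> R) : cocycle d ->
  forall (p : nat) (x : path_space n) (g : cuntz n),
    arrow g = (x, p%:Z, shift p x) -> d g = birkhoff (fun_of_cocycle d) p x.
Proof.
move=> dP; elim=> [|p IH] x g gE.
  have := cocycleD dP gE gE gE erefl; rewrite /birkhoff big_geq// => dE.
  by apply: (addrI (d g)); rewrite addr0 -dE.
have hP : (x, p%:Z, shift p x) \in @cuntz_set n.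
  by rewrite inE; apply/cuntz_set_orbit; exists p, 0%N; rewrite subr0.
rewrite (@cocycleD _ _ d (Cuntz _ hP) (shift_arrow (shift p x)) g _ _ _ _ _ _ dP
           erefl erefl gE); last by lia.
by rewrite (IH x)// /birkhoff [RHS]big_nat_recr.
Qed.

(** Additivity along (x, k, y)(y, q, z) = (x, p, z), where z = S^p x = S^q y, reduces
    the value at any arrow to two values at forward arrows. *)
Lemma cocycle_birkhoff (R : realType) (n : nat) (d : cuntz n -> R) (g : cuntz n) :
  cocycle d ->
  orbit_sum (fun_of_cocycle d) (arrow g).1.1 (arrow g).1.2 (arrow g).2 (d g).
Proof.
move=> dP; case: g => -[[x k] y] gP /=.
have := set_mem gP => /cuntz_set_orbit[p [q [kE xy]]].
exists p, q; split=> //.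
have xzP : (x, p%:Z, shift p x) \in @cuntz_set n.
  by rewrite inE; apply/cuntz_set_orbit; exists p, 0%N; rewrite subr0.
have yzP : (y, q%:Z, shift p x) \in @cuntz_set n.
  by rewrite inE; apply/cuntz_set_orbit; exists q, 0%N; rewrite subr0.
rewrite -(cocycle_forward dP (g := Cuntz _ xzP) erefl).
rewrite -(cocycle_forward dP (g := Cuntz _ yzP)) /= ?xy//.
rewrite (@cocycleD _ _ d (Cuntz _ gP) (Cuntz _ yzP) (Cuntz _ xzP) _ _ _ _ _ _ dP
           erefl erefl erefl); last by lia.
by rewrite addrK.
Qed.

Lemma fun_of_cocycleK (R : realType) (n : nat) (d : cuntz n -> R) :
  cocycle d -> cocycle_of_fun (fun_of_cocycle d) = d.
Proof. by move=> dP; apply/funext => g; apply/cocycle_of_funE/cocycle_birkhoff. Qed.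

Theorem theorem2 (R : realType) (n : nat) (hn : (2 <= n)%N) :
  [/\ forall d : cuntz n -> R, cocycle d -> continuous (fun_of_cocycle d),
      forall f : path_space n -> R, continuous f ->
        (forall g : cuntz n, exists! v : R, cocycle_value f g v) /\
        cocycle (cocycle_of_fun f),
      forall d : cuntz n -> R, cocycle d ->
        cocycle_of_fun (fun_of_cocycle d) = d,
      forall f : path_space n -> R, continuous f ->
        fun_of_cocycle (cocycle_of_fun f) = f &
      set_bij [set d : cuntz n -> R | cocycle d]
        [set f : path_space n -> R | continuous f]
        (@fun_of_cocycle R n)].
Proof.
split.
- by move=> d; exact: fun_of_cocycle_continuous.
- move=> f fc; split; last exact: cocycle_of_fun_cocycle.
  move=> g; have [v gv] := cocycle_value_exists f g.
  exists v; split=> // w gw.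
  exact: orbit_sum_unique (cocycle_value_orbit_sum gv) (cocycle_value_orbit_sum gw).
- by move=> d; exact: fun_of_cocycleK.
- by move=> f _; exact: cocycle_of_funK.
split.
- by move=> d /=; exact: fun_of_cocycle_continuous.
- move=> d e; rewrite !inE /= => dP eP de.
  by rewrite -(fun_of_cocycleK dP) de fun_of_cocycleK.
- move=> f fc; exists (cocycle_of_fun f); first exact: cocycle_of_fun_cocycle.
  exact: cocycle_of_funK.
Qed.
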